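(* $\mathsf{Int2GC{+}FS}=\mathsf{IK}\otimes\mathsf{IK}{+}\mathsf{BR}$; that is, the two logics have the same theorems.
   Context: $\Phi$ is the set of formulas built from a countably infinite set $\mathit{Var}$ of propositional variables with the connectives $\neg,\vee,\wedge,\to$ and the unary operators $\Diamond,\Box,\dot{\Diamond},\blacksquare$. Put $\top:=p\to p$ for a fixed variable $p$, $\bot:=\neg\top$. Axioms are understood as schemes. $\mathsf{Int2GC}$ is the smallest set of formulas of $\Phi$ that contains all instances (in the language $\Phi$) of theorems of intuitionistic propositional logic and is closed under modus ponens and the four rules: from $A\to\blacksquare B$ infer $\Diamond A\to B$; from $\Diamond A\to B$ infer $A\to\blacksquare B$; from $A\to\Box B$ infer $\dot{\Diamond} A\to B$; from $\dot{\Diamond} A\to B$ infer $A\to\Box B$. $\mathsf{Int2GC{+}FS}$ is the smallest extension of $\mathsf{Int2GC}$, closed under the same rules, containing the axioms (FS1) $\Diamond(A\to B)\to(\Box A\to\Diamond B)$ and (FS2) $\dot{\Diamond}(A\to B)\to(\blacksquare A\to\dot{\Diamond} B)$. Fischer Servi's intuitionistic modal logic $\mathsf{IK}$ with modalities $(\Diamond,\Box)$ is intuitionistic propositional logic together with the axioms (IK1) $\Diamond(A\vee B)\to\Diamond A\vee\Diamond B$; (IK2) $\Box A\wedge\Box B\to\Box(A\wedge B)$; (IK3) $\neg\Diamond\bot$; (IK4) $\Diamond(A\to B)\to(\Box A\to\Diamond B)$; (IK5) $(\Diamond A\to\Box B)\to\Box(A\to B)$; modus ponens, and the monotonicity rules: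 from $A\to B$ infer $\Diamond A\to\Diamond B$, and from $A\to B$ infer $\Box A\to\Box B$. $\mathsf{IK}\otimes\mathsf{IK}$ (fusion) is the smallest logic in the language $\Phi$ containing two copies of $\mathsf{IK}$, one with modalities $(\Diamond,\Box)$ and one with modalities $(\dot{\Diamond},\blacksquare)$ in place of $(\Diamond,\Box)$, and closed under the rules of both copies. $\mathsf{IK}\otimes\mathsf{IK}{+}\mathsf{BR}$ is the smallest extension of $\mathsf{IK}\otimes\mathsf{IK}$, closed under the same rules, containing the Brouwerian axioms (BR1) $A\to\blacksquare\Diamond A$, (BR2) $\Diamond\blacksquare A\to A$, (BR3) $A\to\Box\dot{\Diamond} A$, (BR4) $\dot{\Diamond}\Box A\to A$. *)

(* Defs.v *)
(* Intuitionistic propositional logic in its own modality-free language, with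
   [nat] as the countably infinite set of variables. Negation is primitive. *)
Inductive pform : Type :=
| PVar (n : nat)
| PNeg (A : pform)
| POr (A B : pform)
| PAnd (A B : pform)
| PImp (A B : pform).

(* Kleene's Hilbert-style axiomatization, without double negation elimination. *)
Inductive IPC : pform -> Prop :=
| IPC_K A B : IPC (PImp A (PImp B A))
| IPC_S A B C :
    IPC (PImp (PImp A (PImp B C)) (PImp (PImp A B) (PImp A C)))
| IPC_andI A B : IPC (PImp A (PImp B (PAnd A B)))
| IPC_andE1 A B : IPC (PImp (PAnd A B) A)
| IPC_andE2 A B : IPC (PImp (PAnd A B) B)
| IPC_orI1 A B : IPC (PImp A (POr A B))
| IPC_orI2 A B : IPC (PImp B (POr A B))
| IPC_orE A B C :
    IPC (PImp (PImp A C) (PImp (PImp B C) (PImp (POr A B) C)))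
| IPC_negI A B : IPC (PImp (PImp A B) (PImp (PImp A (PNeg B)) (PNeg A)))
| IPC_negE A B : IPC (PImp (PNeg A) (PImp A B))
| IPC_mp A B : IPC (PImp A B) -> IPC A -> IPC B.

(* [Dia], [Box], [DotDia], [BBox] are the lozenge, the white square, the dotted
   lozenge and the black square. The adjoint pairs of the Galois connections
   are ([Dia], [BBox]) and ([DotDia], [Box]), whereas the copies of IK are on
   ([Dia], [Box]) and ([DotDia], [BBox]). *)
Inductive form : Type :=
| Var (n : nat)
| Neg (A : form)
| Or (A B : form)
| And (A B : form)
| Imp (A B : form)
| Dia (A : form)
| Box (A : form)
| DotDia (A : form)
| BBox (A : form).

Declare Scope form_scope.
Delimit Scope form_scope with form.
Bind Scope form_scope with form.
Notation "A '~>' B" := (Imp A B)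
  (at level 90, right associativity) : form_scope.
Notation "A '|||' B" := (Or A B)
  (at level 85, right associativity) : form_scope.
Notation "A '&&&' B" := (And A B)
  (at level 80, right associativity) : form_scope.
Local Open Scope form_scope.

Definition top (p : nat) : form := Var p ~> Var p.
Definition bot (p : nat) : form := Neg (top p).

Fixpoint inst (s : nat -> form) (P : pform) : form :=
  match P with
  | PVar n => s n
  | PNeg P => Neg (inst s P)
  | POr P Q => inst s P ||| inst s Q
  | PAnd P Q => inst s P &&& inst s Q
  | PImp P Q => inst s P ~> inst s Q
  end.

Inductive IPC_instance : form -> Prop :=
| IPC_instance_intro (s : nat -> form) (P : pform) :
    IPC P -> IPC_instance (inst s P).

Definition union (X Y : form -> Prop) (A : form) : Prop := X A \/ Y A.

(* The smallest set of formulas that contains [X] and is closed under modus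
   ponens and the one-premise rules "from [A] infer [B]" with [rule A B]. *)
Inductive closure (X : form -> Prop) (rule : form -> form -> Prop) :
  form -> Prop :=
| closure_base A : X A -> closure X rule A
| closure_mp A B :
    closure X rule (A ~> B) -> closure X rule A -> closure X rule B
| closure_rule A B : rule A B -> closure X rule A -> closure X rule B.

Inductive GC_rule : form -> form -> Prop :=
| GC_BBox_Dia A B : GC_rule (A ~> BBox B) (Dia A ~> B)
| GC_Dia_BBox A B : GC_rule (Dia A ~> B) (A ~> BBox B)
| GC_Box_DotDia A B : GC_rule (A ~> Box B) (DotDia A ~> B)
| GC_DotDia_Box A B : GC_rule (DotDia A ~> B) (A ~> Box B).

Definition Int2GC : form -> Prop := closure IPC_instance GC_rule.

Inductive FS_axiom : form -> Prop :=
| FS1 A B : FS_axiom (Dia (A ~> B) ~> (Box A ~> Dia B))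
| FS2 A B : FS_axiom (DotDia (A ~> B) ~> (BBox A ~> DotDia B)).

Definition Int2GC_FS : form -> Prop := closure (union Int2GC FS_axiom) GC_rule.

(* Schemes over all of [form], for the pair of modalities ([dia], [box]). *)
Inductive IK_axiom (p : nat) (dia box : form -> form) : form -> Prop :=
| IK1 A B : IK_axiom p dia box (dia (A ||| B) ~> dia A ||| dia B)
| IK2 A B : IK_axiom p dia box (box A &&& box B ~> box (A &&& B))
| IK3 : IK_axiom p dia box (Neg (dia (bot p)))
| IK4 A B : IK_axiom p dia box (dia (A ~> B) ~> (box A ~> dia B))
| IK5 A B : IK_axiom p dia box ((dia A ~> box B) ~> box (A ~> B)).

Inductive IK_rule (dia box : form -> form) : form -> form -> Prop :=
| IK_mono_dia A B : IK_rule dia box (A ~> B) (dia A ~> dia B)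
| IK_mono_box A B : IK_rule dia box (A ~> B) (box A ~> box B).

Definition IK (p : nat) (dia box : form -> form) : form -> Prop :=
  closure (union IPC_instance (IK_axiom p dia box)) (IK_rule dia box).

Definition IKIK_rule (A B : form) : Prop :=
  IK_rule Dia Box A B \/ IK_rule DotDia BBox A B.

Definition IKIK (p : nat) : form -> Prop :=
  closure (union (IK p Dia Box) (IK p DotDia BBox)) IKIK_rule.

Inductive BR_axiom : form -> Prop :=
| BR1 A : BR_axiom (A ~> BBox (Dia A))
| BR2 A : BR_axiom (Dia (BBox A) ~> A)
| BR3 A : BR_axiom (A ~> Box (DotDia A))
| BR4 A : BR_axiom (DotDia (Box A) ~> A).

Definition IKIK_BR (p : nat) : form -> Prop :=
  closure (union (IKIK p) BR_axiom) IKIK_rule.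

(* Main.v *)
Require Import Defs.

(** Over intuitionistic logic the four rules of [Int2GC] say that [Dia] is left
    adjoint to [BBox] and [DotDia] left adjoint to [Box]. A pair of operators
    is adjoint exactly when both are monotone and there are a unit
    [A ~> g (f A)] and a counit [f (g A) ~> A]; the Brouwerian axioms are these
    units and counits, and monotonicity is what the rules of IK provide. So
    both systems have the same adjunctions, and it remains to compare the Fischer
    Servi axioms with those of the two copies of IK.

    (FS1) and (FS2) are (IK4) for the two copies of IK. Conversely, with the
    adjunctions at hand, (IK1) and (IK3) hold because left adjoints preserve
    finite joins, (IK2) because right adjoints preserve meets, and (IK5) for one
    copy is the transpose of (IK4) for the other copy: the adjoint form
    [DotDia (Dia A ~> Box B) ~> (A ~> B)] follows from
    [DotDia (Dia A ~> Box B) ~> (BBox (Dia A) ~> DotDia (Box B))] by the unit at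
    [A] and the counit at [B] ([IK_axiom_of_adjunctions]).

    The argument for one copy of IK becomes the argument for the other when
    the two adjunctions are exchanged, so the lemmas are stated for arbitrary
    unary operators on formulas. *)

Local Open Scope form_scope.

(** * Intuitionistic reasoning in a set of formulas *)

Definition intuitionistic (L : form -> Prop) : Prop :=
  (forall A, IPC_instance A -> L A) /\
  (forall A B, L (A ~> B) -> L A -> L B).

Definition valuation (A B C : form) (n : nat) : form :=
  match n with 0 => A | 1 => B | _ => C end.

Section Intuitionistic.

Variable L : form -> Prop.
Hypothesis HL : intuitionistic L.

Lemma logic_mp A B : L (A ~> B) -> L A -> L B.
Proof. exact (proj2 HL A B). Qed.

Lemma logic_instance (s : nat -> form) P : IPC P -> L (inst s P).
Proof. intro HP. apply (proj1 HL). now constructor. Qed.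

Lemma logic_K A B : L (A ~> B ~> A).
Proof. exact (logic_instance (valuation A B B) _ (IPC_K (PVar 0) (PVar 1))). Qed.

Lemma logic_S A B C : L ((A ~> B ~> C) ~> (A ~> B) ~> A ~> C).
Proof.
  exact (logic_instance (valuation A B C) _
           (IPC_S (PVar 0) (PVar 1) (PVar 2))).
Qed.

Lemma imp_refl A : L (A ~> A).
Proof.
  apply (logic_mp (A ~> A ~> A)); [|apply logic_K].
  apply (logic_mp (A ~> (A ~> A) ~> A)); [apply logic_S | apply logic_K].
Qed.

Lemma imp_weaken A B : L B -> L (A ~> B).
Proof. apply logic_mp, logic_K. Qed.

Lemma imp_app X A B : L (X ~> A ~> B) -> L (X ~> A) -> L (X ~> B).
Proof. intro H. apply logic_mp. revert H. apply logic_mp, logic_S. Qed.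

Lemma imp_trans A B C : L (A ~> B) -> L (B ~> C) -> L (A ~> C).
Proof. intros HAB HBC. apply imp_app with B; [now apply imp_weaken | exact HAB]. Qed.

Lemma imp_discharge X A B : L (X ~> A ~> B) -> L A -> L (X ~> B).
Proof. intros H HA. apply imp_app with A; [exact H | now apply imp_weaken]. Qed.

Lemma imp_mono A A' B B' :
  L (A' ~> A) -> L (B ~> B') -> L ((A ~> B) ~> (A' ~> B')).
Proof.
  intros HA HB. apply imp_trans with (A ~> B').
  - apply logic_mp with (A ~> B ~> B'); [apply logic_S | now apply imp_weaken].
  - apply imp_discharge with (A' ~> A); [|exact HA].
    apply imp_trans with (A' ~> A ~> B'); [apply logic_K | apply logic_S].
Qed.

Lemma or_intro_l A B : L (A ~> A ||| B).
Proof. exact (logic_instance (valuation A B B) _ (IPC_orI1 (PVar 0) (PVar 1))). Qed.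

Lemma or_intro_r A B : L (B ~> A ||| B).
Proof. exact (logic_instance (valuation A B B) _ (IPC_orI2 (PVar 0) (PVar 1))). Qed.

Lemma or_elim A B C : L (A ~> C) -> L (B ~> C) -> L (A ||| B ~> C).
Proof.
  intros HA. apply logic_mp. revert HA. apply logic_mp.
  exact (logic_instance (valuation A B C) _
           (IPC_orE (PVar 0) (PVar 1) (PVar 2))).
Qed.

Lemma and_elim_l A B : L (A &&& B ~> A).
Proof. exact (logic_instance (valuation A B B) _ (IPC_andE1 (PVar 0) (PVar 1))). Qed.

Lemma and_elim_r A B : L (A &&& B ~> B).
Proof. exact (logic_instance (valuation A B B) _ (IPC_andE2 (PVar 0) (PVar 1))). Qed.

Lemma and_intro X A B : L (X ~> A) -> L (X ~> B) -> L (X ~> A &&& B).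
Proof.
  intros HA. apply imp_app. apply imp_trans with A; [exact HA|].
  exact (logic_instance (valuation A B B) _ (IPC_andI (PVar 0) (PVar 1))).
Qed.

Lemma bot_elim p A : L (bot p ~> A).
Proof.
  apply imp_discharge with (top p); [|apply imp_refl].
  exact (logic_instance (valuation (top p) A A) _ (IPC_negE (PVar 0) (PVar 1))).
Qed.

Lemma neg_of_imp_bot p A : L (A ~> bot p) -> L (Neg A).
Proof.
  apply logic_mp. apply logic_mp with (A ~> top p).
  - exact (logic_instance (valuation A (top p) A) _
             (IPC_negI (PVar 0) (PVar 1))).
  - apply imp_weaken, imp_refl.
Qed.

(** * Adjoint pairs of operators *)

Definition monotone (f : form -> form) : Prop :=
  forall A B, L (A ~> B) -> L (f A ~> f B).

Definition adjoint (f g : form -> form) : Prop :=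
  forall A B, L (f A ~> B) <-> L (A ~> g B).

Lemma adjoint_unit f g A : adjoint f g -> L (A ~> g (f A)).
Proof. intro H. apply H, imp_refl. Qed.

Lemma adjoint_counit f g A : adjoint f g -> L (f (g A) ~> A).
Proof. intro H. apply H, imp_refl. Qed.

Lemma left_adjoint_monotone f g : adjoint f g -> monotone f.
Proof.
  intros H A B HAB. apply H. apply imp_trans with B; [exact HAB|].
  now apply adjoint_unit.
Qed.

Lemma right_adjoint_monotone f g : adjoint f g -> monotone g.
Proof.
  intros H A B HAB. apply H. apply imp_trans with A; [|exact HAB].
  now apply adjoint_counit.
Qed.

Lemma adjoint_of_unit_counit f g :
  monotone f -> monotone g ->
  (forall A, L (A ~> g (f A))) -> (forall A, L (f (g A) ~> A)) ->
  adjoint f g.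
Proof.
  intros Hf Hg Hunit Hcounit A B. split; intro H.
  - apply imp_trans with (g (f A)); [apply Hunit | now apply Hg].
  - apply imp_trans with (f (g B)); [now apply Hf | apply Hcounit].
Qed.

(** The modalities ([dia], [box]) of a copy of IK belong to different adjoint
    pairs: (IK1) and (IK3) follow by transposing along the adjunction of [dia],
    (IK2) and (IK5) along that of [box]. Only (IK5) makes the two
    adjunctions interact, through the Fischer Servi axiom of the other copy
    ([dia'], [box']). *)
Lemma IK_axiom_of_adjunctions p (dia box dia' box' : form -> form) :
  adjoint dia box' -> adjoint dia' box ->
  (forall A B, L (dia (A ~> B) ~> (box A ~> dia B))) ->
  (forall A B, L (dia' (A ~> B) ~> (box' A ~> dia' B))) ->
  forall A, IK_axiom p dia box A -> L A.
Proof.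
  intros Hdia Hbox HFS HFS' _ [A B|A B| |A B|A B].
  - apply Hdia, or_elim; apply Hdia; [apply or_intro_l | apply or_intro_r].
  - apply Hbox, and_intro; apply Hbox; [apply and_elim_l | apply and_elim_r].
  - apply neg_of_imp_bot with p. apply Hdia, bot_elim.
  - apply HFS.
  - apply Hbox. apply imp_trans with (box' (dia A) ~> dia' (box B)).
    + apply HFS'.
    + apply imp_mono; [now apply adjoint_unit | now apply adjoint_counit].
Qed.

(** * Logics as least closed sets *)

Lemma closure_least X rule :
  (forall A, X A -> L A) -> (forall A B, rule A B -> L A -> L B) ->
  forall A, closure X rule A -> L A.
Proof.
  intros HX Hrule A H.
  induction H as [A HA | A B _ HAB _ HA | A B HAB _ HA].
  - now apply HX.
  - now apply logic_mp with A.
  - now apply Hrule with A.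
Qed.

Lemma IK_rule_of_monotone dia box A B :
  monotone dia -> monotone box -> IK_rule dia box A B -> L A -> L B.
Proof. intros Hdia Hbox [C D | C D]; [apply Hdia | apply Hbox]. Qed.

Lemma IK_least p dia box :
  monotone dia -> monotone box ->
  (forall A, IK_axiom p dia box A -> L A) ->
  forall A, IK p dia box A -> L A.
Proof.
  intros Hdia Hbox Hax. apply closure_least.
  - intros A [HA | HA]; [now apply (proj1 HL) | now apply Hax].
  - intros A B. now apply IK_rule_of_monotone.
Qed.

Lemma Int2GC_FS_least :
  adjoint Dia BBox -> adjoint DotDia Box ->
  (forall A, FS_axiom A -> L A) ->
  forall A, Int2GC_FS A -> L A.
Proof.
  intros Hdia Hdot HFS.
  assert (Hrule : forall A B, GC_rule A B -> L A -> L B).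
  { intros _ _ [A B|A B|A B|A B]; [apply Hdia .. | apply Hdot | apply Hdot]. }
  apply closure_least; [|exact Hrule].
  intros A [HA | HA]; [|now apply HFS].
  revert A HA. apply closure_least; [exact (proj1 HL) | exact Hrule].
Qed.

Lemma IKIK_BR_least p :
  monotone Dia -> monotone Box -> monotone DotDia -> monotone BBox ->
  (forall A, IK_axiom p Dia Box A -> L A) ->
  (forall A, IK_axiom p DotDia BBox A -> L A) ->
  (forall A, BR_axiom A -> L A) ->
  forall A, IKIK_BR p A -> L A.
Proof.
  intros Hdia Hbox Hdot Hbbox Hax Hax' HBR.
  assert (Hrule : forall A B, IKIK_rule A B -> L A -> L B).
  { intros A B [H | H]; revert H; now apply IK_rule_of_monotone. }
  apply closure_least; [|exact Hrule].
  intros A [HA | HA]; [|now apply HBR].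
  revert A HA. apply closure_least; [|exact Hrule].
  intros A [HA | HA]; revert HA; now apply IK_least.
Qed.

End Intuitionistic.

(** * The closure properties of the two logics *)

Lemma Int2GC_FS_intuitionistic : intuitionistic Int2GC_FS.
Proof.
  split.
  - intros A HA. apply closure_base. left. now apply closure_base.
  - apply closure_mp.
Qed.

Lemma Int2GC_FS_adjoint_Dia : adjoint Int2GC_FS Dia BBox.
Proof. intros A B. split; apply closure_rule; constructor. Qed.

Lemma Int2GC_FS_adjoint_DotDia : adjoint Int2GC_FS DotDia Box.
Proof. intros A B. split; apply closure_rule; constructor. Qed.

Lemma Int2GC_FS_axiom A : FS_axiom A -> Int2GC_FS A.
Proof. intro HA. apply closure_base. now right. Qed.

Section IKIK_BR.

Variable p : nat.

Lemma IKIK_BR_intuitionistic : intuitionistic (IKIK_BR p).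
Proof.
  split.
  - intros A HA. apply closure_base. left. apply closure_base. left.
    apply closure_base. now left.
  - apply closure_mp.
Qed.

Lemma IKIK_BR_monotone :
  (monotone (IKIK_BR p) Dia /\ monotone (IKIK_BR p) Box) /\
  (monotone (IKIK_BR p) DotDia /\ monotone (IKIK_BR p) BBox).
Proof.
  repeat split; intros A B; apply closure_rule;
    (left; constructor) || (right; constructor).
Qed.

Lemma IKIK_BR_axiom A : BR_axiom A -> IKIK_BR p A.
Proof. intro HA. apply closure_base. now right. Qed.

Lemma IKIK_BR_FS A : FS_axiom A -> IKIK_BR p A.
Proof.
  intros [B C | B C]; apply closure_base; left; apply closure_base;
    [left | right]; apply closure_base; right; apply IK4.
Qed.

End IKIK_BR.

Theorem proposition2p3 (p : nat) :
  forall A : form, Int2GC_FS A <-> IKIK_BR p A.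
Proof.
  intro A. split; revert A.
  - pose proof (IKIK_BR_intuitionistic p) as HL.
    destruct (IKIK_BR_monotone p) as [[Hdia Hbox] [Hdot Hbbox]].
    apply Int2GC_FS_least; [exact HL | | | apply IKIK_BR_FS];
      apply adjoint_of_unit_counit; trivial;
      intro A; apply IKIK_BR_axiom; constructor.
  - pose proof Int2GC_FS_intuitionistic as HL.
    pose proof Int2GC_FS_adjoint_Dia as Hdia.
    pose proof Int2GC_FS_adjoint_DotDia as Hdot.
    assert (HFS1 : forall A B,
              Int2GC_FS (Dia (A ~> B) ~> (Box A ~> Dia B)))
      by (intros; apply Int2GC_FS_axiom, FS1).
    assert (HFS2 : forall A B,
              Int2GC_FS (DotDia (A ~> B) ~> (BBox A ~> DotDia B)))
      by (intros; apply Int2GC_FS_axiom, FS2).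
    apply IKIK_BR_least; trivial.
    + now apply left_adjoint_monotone with BBox.
    + now apply right_adjoint_monotone with DotDia.
    + now apply left_adjoint_monotone with Box.
    + now apply right_adjoint_monotone with Dia.
    + now apply IK_axiom_of_adjunctions with (dia' := DotDia) (box' := BBox).
    + now apply IK_axiom_of_adjunctions with (dia' := Dia) (box' := Box).
    + intros _ [A|A|A|A].
      * now apply adjoint_unit.
      * now apply adjoint_counit.
      * now apply adjoint_unit.
      * now apply adjoint_counit.
Qed.
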